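(* Let $X^{(0)}$ be a closed real interval, let $f\in C(X^{(0)})$ be a real-valued, continuously differentiable function, and let $F'$ be an inclusion monotonic interval extension of $f'$. Let $\{X^{(k)}\}$ be the sequence of intervals generated from $X^{(0)}$ by $$Y^{(k)} = N(X^{(k)})\cap X^{(k)},\qquad Z^{(k)} = K(X^{(k)},Y^{(k)})\cap Y^{(k)},\qquad X^{(k+1)} = T(X^{(k)},Y^{(k)},Z^{(k)})\cap Z^{(k)},$$ for $k=0,1,2,\dots$, with $N$, $K$, $T$ as defined in the context. Suppose $0\notin F'(X^{(k)})$ for $k=0,1,2,\dots$. If $X^{(0)}$ contains a root $x^*$ of $f$, then so do the intervals $X^{(k)}$, $k=1,2,\dots$ (that is, $x^*\in X^{(k)}$ for all $k$). Moreover, the interval sequence $\{X^{(k)}\}$ is nested and converges to $x^*$.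
   Context: A real interval is a closed bounded interval $X=[\underline{x},\overline{x}]=\{x\in\mathbb{R} : \underline{x}\le x\le\overline{x}\}$; a real number $x$ is identified with $[x,x]$. The midpoint is $m(X)=\frac12(\underline{x}+\overline{x})$. For intervals $X,Y$ and $\oplus\in\{+,-,\cdot,/\}$, $X\oplus Y=\{x\oplus y : x\in X, y\in Y\}$, where division requires $0\notin Y$. An interval-valued function $F$ of intervals is an interval extension of a real function $f$ if $F([x,x])=f(x)$ for all $x$ and $F(X)\supseteq\{f(x):x\in X\}$ for all intervals $X$. It is inclusion monotonic if $X\subseteq Y$ implies $F(X)\subseteq F(Y)$. Here $F'$ denotes an inclusion monotonic interval extension of the derivative $f'$, defined on subintervals of $X^{(0)}$. A sequence of intervals is nested if $X^{(k+1)}\subseteq X^{(k)}$ for all $k$. The limit of a nested sequence is $\bigcap_{k=0}^\infty X^{(k)}$; it converges to $x^*$ if this intersection equals $\{x^*\}$. For intervals $X,Y,Z$ with midpoints $x=m(X)$, $y=m(Y)$, $z=m(Z)$, define $$N(X)=x-\frac{f(x)}{F'(X)},$$ $$K(X,Y)=y-\frac{f(x)f(y)}{(f(x)-f(y))^2}\,\frac{f(x)}{F'(X)},$$ $$T(X,Y,Z)=z-\frac{f(x)f(y)f(z)\left(f(x)^2+f(y)(f(y)-f(z))\right)}{(f(x)-f(y))^2(f(x)-f(z))^2(f(y)-f(z))}\,\frac{f(x)}{F'(X)},$$ where the operations involving $F'(X)$ are interval operations. The real denominators occurring in these formulas are understood to be nonzero at every step at which they are used. If an intersection in the iteration is empty,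 the iteration stops with an empty interval.
   Formalization: The formal theorem also assumes that every X^(k) is nonempty (so that F'(X^(k)) is defined); without this the claim fails, e.g. f(x)=x, X^(0)=[-0.15,0.35], F'(A)=[1-w(A),1] with w the width, where X^(1) loses the root 0. *)

(* Defs.v *)
From mathcomp Require Import all_boot all_order all_algebra.
From mathcomp Require Import all_classical all_reals all_analysis.

Set Implicit Arguments.
Unset Strict Implicit.
Unset Printing Implicit Defensive.

Import Order.TTheory GRing.Theory Num.Theory.
Import numFieldNormedType.Exports.

Local Open Scope classical_set_scope.
Local Open Scope ring_scope.

(* Intervals are represented by their sets of points; a real number x is
   identified with the singleton [set x]. *)
Definition real_interval (R : realType) (A : set R) : Prop :=
  exists a b : R, a <= b /\ A = [set` `[a, b]].

(* For A = [a, b] with a <= b, inf A = a and sup A = b. *)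
Definition midpoint (R : realType) (A : set R) : R := (inf A + sup A) / 2.

Definition isub (R : realType) (A B : set R) : set R :=
  [set a - b | a in A & b in B].

Definition imul (R : realType) (A B : set R) : set R :=
  [set a * b | a in A & b in B].

(* Only meaningful when 0 is not in B. *)
Definition idiv (R : realType) (A B : set R) : set R :=
  [set a / b | a in A & b in B].

(* F is only constrained on the subintervals of D, and g only on D. *)
Definition interval_extension (R : realType) (D : set R)
    (F : set R -> set R) (g : R -> R) : Prop :=
  [/\ forall A, real_interval A -> A `<=` D -> real_interval (F A),
      forall x, D x -> F [set x] = [set g x] &
      forall A, real_interval A -> A `<=` D -> g @` A `<=` F A].

Definition inclusion_monotonic (R : realType) (D : set R)
    (F : set R -> set R) : Prop :=
  forall A B, real_interval A -> real_interval B -> B `<=` D ->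
    A `<=` B -> F A `<=` F B.

(* f is continuously differentiable on D with derivative df; the difference
   quotients are restricted to D, so the derivatives at the end points of an
   interval D are one-sided. *)
Definition C1_on (R : realType) (D : set R) (f df : R -> R) : Prop :=
  [/\ {within D, continuous f},
      forall x, D x ->
        (fun y => (f y - f x) / (y - x)) @ within D (x^') --> df x &
      {within D, continuous df}].

Definition Nop (R : realType) (f : R -> R) (F : set R -> set R)
    (X : set R) : set R :=
  let x := midpoint X in
  isub [set x] (idiv [set f x] (F X)).

Definition Kden (R : realType) (f : R -> R) (X Y : set R) : R :=
  let x := midpoint X in let y := midpoint Y in
  (f x - f y) ^+ 2.

Definition Kop (R : realType) (f : R -> R) (F : set R -> set R)
    (X Y : set R) : set R :=
  let x := midpoint X in let y := midpoint Y in
  isub [set y]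
    (imul [set f x * f y / Kden f X Y] (idiv [set f x] (F X))).

Definition Tden (R : realType) (f : R -> R) (X Y Z : set R) : R :=
  let x := midpoint X in let y := midpoint Y in let z := midpoint Z in
  (f x - f y) ^+ 2 * (f x - f z) ^+ 2 * (f y - f z).

Definition Top (R : realType) (f : R -> R) (F : set R -> set R)
    (X Y Z : set R) : set R :=
  let x := midpoint X in let y := midpoint Y in let z := midpoint Z in
  isub [set z]
    (imul [set f x * f y * f z * (f x ^+ 2 + f y * (f y - f z))
               / Tden f X Y Z]
          (idiv [set f x] (F X))).

(* Once an intersection is empty, all later terms are empty as well, whatever
   value the operators take there: this is how an iteration that stops with an
   empty interval is represented. *)
Definition generated (R : realType) (f : R -> R) (F : set R -> set R)
    (X Y Z : nat -> set R) : Prop :=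
  forall k : nat,
    [/\ Y k = Nop f F (X k) `&` X k,
        Z k = Kop f F (X k) (Y k) `&` Y k &
        X k.+1 = Top f F (X k) (Y k) (Z k) `&` Z k].

(* A denominator is used only if the intervals whose midpoints occur in it
   are nonempty. Here Z k is contained in Y k and Y k in X k. *)
Definition denominators_nonzero (R : realType) (f : R -> R)
    (X Y Z : nat -> set R) : Prop :=
  forall k : nat,
    (Y k !=set0 -> Kden f (X k) (Y k) != 0) /\
    (Z k !=set0 -> Tden f (X k) (Y k) (Z k) != 0).

(* F is defined at A only if A is a nonempty interval, so "0 is not in F(A)"
   includes A being nonempty; F set0 is a junk value. *)
Definition zero_notin_value (R : realType) (F : set R -> set R)
    (A : set R) : Prop :=
  A !=set0 /\ ~ F A 0.

Definition nested (R : realType) (X : nat -> set R) : Prop :=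
  forall k : nat, X k.+1 `<=` X k.

(* Convergence of a nested sequence. *)
Definition converges_to (R : realType) (X : nat -> set R) (x : R) : Prop :=
  \bigcap_k X k = [set x].

(* Main.v *)
(* By hypothesis no X^(k) is empty. N(X) lies on one side of the midpoint of X,
   so the diameters at least halve at each step. Since Y^(k) is nonempty, the
   Newton step |f(x)/q|, with x the midpoint of X^(k) and q in F'(X^(k)), does
   not exceed the diameter of X^(k), while it is at least r |x - x^*| with r > 0
   independent of k. Hence the intervals shrink to x^*, and, being closed and
   nested, they all contain it. The correction terms in K and T play no role
   beyond keeping the iterates closed intervals: x^* in K(X, Y) or
   x^* in T(X, Y, Z) is never shown directly. *)
Require Import Defs.
From mathcomp Require Import all_boot all_order all_algebra.
From mathcomp Require Import all_classical all_reals all_analysis.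
From mathcomp Require Import lra.

Set Implicit Arguments.
Unset Strict Implicit.
Unset Printing Implicit Defensive.

Import Order.TTheory GRing.Theory Num.Theory.
Import numFieldNormedType.Exports.

Local Open Scope classical_set_scope.
Local Open Scope ring_scope.

(** * Closure of intervals under the operations of the iteration *)

Lemma real_intervalI (R : realType) (A B : set R) :
  real_interval A -> real_interval B -> A `&` B !=set0 ->
  real_interval (A `&` B).
Proof.
move=> [a [b [leab ->]]] [c [d [lecd ->]]] [x []].
rewrite /= !in_itv /= => /andP[ax xb] /andP[cx xd].
exists (Num.max a c), (Num.min b d); split.
  by rewrite le_min !ge_max; lra.
apply/seteqP; split=> y /=; rewrite !in_itv /= le_min ge_max.
  by case=> /andP[-> ->] /andP[-> ->].
by move=> /andP[/andP[-> ->] /andP[-> ->]].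
Qed.

Lemma real_interval_isub1 (R : realType) (x : R) (A : set R) :
  real_interval A -> real_interval (isub [set x] A).
Proof.
move=> [a [b [leab ->]]]; exists (x - b), (x - a); split; first lra.
apply/seteqP; split=> y /=; rewrite in_itv /=.
  by move=> [_ -> [z /= /[!in_itv] /= zab <-]]; lra.
by move=> yab; exists x => //; exists (x - y); rewrite /= ?in_itv /=; lra.
Qed.

Lemma real_interval_imul1 (R : realType) (t : R) (A : set R) :
  real_interval A -> real_interval (imul [set t] A).
Proof.
move=> [a [b [leab ->]]]; have [t0|t0|->] := ltgtP t 0; last first.
- exists 0, 0; split=> //; apply/seteqP; split=> y /=; rewrite in_itv /=.
    by move=> [_ -> [z _ <-]]; rewrite mul0r lexx.
  move=> y0; exists 0 => //; exists a; rewrite /= ?in_itv /= ?lexx //; lra.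
- exists (t * a), (t * b); split; first by rewrite ler_pM2l.
  apply/seteqP; split=> y /=; rewrite in_itv /=.
    by move=> [_ -> [z /= /[!in_itv] /= zab <-]]; rewrite !ler_pM2l.
  move=> yab; exists t => //; exists (t^-1 * y); last by rewrite mulVKf ?gt_eqF.
  by rewrite /= in_itv /= ler_pdivlMl // ler_pdivrMl.
- exists (t * b), (t * a); split; first by rewrite ler_nM2l.
  apply/seteqP; split=> y /=; rewrite in_itv /=.
    by move=> [_ -> [z /= /[!in_itv] /= zab <-]]; rewrite !ler_nM2l // andbC.
  move=> yab; exists t => //; exists (t^-1 * y); last by rewrite mulVKf ?lt_eqF.
  by rewrite /= in_itv /= ler_ndivlMl // ler_ndivrMl // andbC.
Qed.

Lemma real_interval_0notin (R : realType) (B : set R) :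
  real_interval B -> ~ B 0 ->
  exists c d : R, [/\ c <= d, B = [set` `[c, d]] & 0 < c \/ d < 0].
Proof.
move=> [c [d [lecd ->]]] /=; rewrite in_itv /= => /negP.
by rewrite negb_and -!ltNge => /orP cd; exists c, d.
Qed.

Lemma real_interval_inv (R : realType) (B : set R) :
  real_interval B -> ~ B 0 -> real_interval [set b^-1 | b in B].
Proof.
move=> iB B0; have [c [d [lecd -> cd0]]] := real_interval_0notin iB B0.
have itvN0 z : z \in `[c, d] -> z != 0.
  by rewrite in_itv /= => zcd; apply/eqP; case: cd0; lra.
have invr_itv (x y z : R) : 0 < x \/ y < 0 -> x <= z <= y ->
    y^-1 <= z^-1 <= x^-1.
  case=> [x0 | y0] /andP[xz zy].
    by rewrite !lef_pV2 ?xz ?zy // posrE; lra.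
  by rewrite !lef_nV2 ?xz ?zy // negrE; lra.
exists d^-1, c^-1; split.
  by have /andP[] : d^-1 <= c^-1 <= c^-1 by apply: invr_itv => //; lra.
apply/seteqP; split=> y /=; rewrite in_itv /=.
  by move=> [z /= /[!in_itv] /= zcd <-]; exact: invr_itv.
(* Surjectivity is the same antitonicity, applied to the interval with ends [d^-1] and [c^-1], which
   also stays on one side of 0. *)
move=> ycd; exists y^-1; rewrite ?invrK //= in_itv /=.
rewrite -[c]invrK -[d]invrK; apply: invr_itv => //.
by rewrite invr_gt0 invr_lt0; lra.
Qed.

Lemma real_interval_idiv1 (R : realType) (t : R) (B : set R) :
  real_interval B -> ~ B 0 -> real_interval (idiv [set t] B).
Proof.
move=> iB B0; have -> : idiv [set t] B = imul [set t] [set b^-1 | b in B].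
  apply/seteqP; split=> y [_ -> [b Bb <-]]; exists t => //.
    by exists b^-1 => //; exists b.
  by case: Bb => {}b Bb <-; exists b.
exact/real_interval_imul1/real_interval_inv.
Qed.

(** An interval that misses 0 has elements of one sign only, so the smallest ratio is that of the
    end nearest 0 to the end farthest from it. *)
Lemma ratio_lower_bound (R : realType) (B : set R) :
  real_interval B -> ~ B 0 ->
  exists2 r : R, 0 < r & forall p q : R, B p -> B q -> r <= p / q.
Proof.
move=> iB B0; have [c [d [lecd -> [c0|d0]]]] := real_interval_0notin iB B0.
  exists (c / d); first by apply: divr_gt0; lra.
  move=> p q; rewrite /= !in_itv /= => pcd qcd.
  by apply: ler_pM; rewrite ?invr_ge0 ?lef_pV2 ?posrE; lra.
exists (d / c); first by rewrite -divrNN; apply: divr_gt0; lra.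
move=> p q; rewrite /= !in_itv /= => pcd qcd.
rewrite -(divrNN d) -(divrNN p).
by apply: ler_pM; rewrite ?invr_ge0 ?lef_pV2 ?posrE; lra.
Qed.

(** * Mean value theorem for [C1_on] *)

(** Near an interior point the restriction of the difference quotients to [[a, b]] is void, so their
    limit is the ordinary derivative. *)
Lemma C1_on_itv_is_derive (R : realType) (a b : R) (f df : R -> R) :
  C1_on [set` `[a, b]] f df ->
  forall x : R, x \in `]a, b[ -> is_derive x 1 f (df x).
Proof.
move=> [_ hd _] x xab; apply/is_derive1_caratheodory.
(* Carathéodory's slope function, with the derivative as its value at [x]. *)
exists (fun y => if y == x then df x else (f y - f x) / (y - x)).
rewrite eqxx; split=> // [y|].
  by case: eqVneq => [->|yx]; rewrite ?subrr ?mulr0 // divfK // subr_eq0.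
apply/continuous_withinNx; rewrite eqxx.
have : (fun y => (f y - f x) / (y - x)) @ x^' --> df x.
  have Dx : [set` `[a, b]] x by apply: subset_itv_oo_cc.
  apply: cvg_trans (hd x Dx) => P /= DP.
  have /= xD : \forall y \near x^', y \in `[a, b].
    apply: nbhs_dnbhs; near=> y; apply: subset_itv_oo_cc.
    by near: y; exact: near_in_itvoo.
  by apply: filterS2 xD DP => y yD /(_ yD).
apply: cvg_trans; apply: near_eq_cvg; near=> y.
by rewrite ifN //; near: y; exact: nbhs_dnbhs_neq.
Unshelve. all: by end_near. Qed.

Lemma C1_on_MVT (R : realType) (D : set R) (f df : R -> R) (u v : R) :
  real_interval D -> C1_on D f df -> D u -> D v ->
  exists2 w : R, D w & f u - f v = df w * (u - v).
Proof.
move=> [a [b [leab ->]]] hf.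
wlog ltuv : u v / u < v => [hwlog Du Dv|].
  have [uv|vu|->] := ltgtP u v; first exact: hwlog.
    have [w Dw e] := hwlog v u vu Dv Du; exists w => //; lra.
  by exists v => //; rewrite !subrr mulr0.
rewrite /= !in_itv /= => uab vab.
have dfuv (x : R) : x \in `]u, v[ -> is_derive x 1 f (df x).
  rewrite in_itv /= => xuv; apply: (C1_on_itv_is_derive hf).
  by rewrite in_itv /=; lra.
have cfuv : {within `[u, v], continuous f}.
  case: hf => cf _ _; apply: continuous_subspaceW cf.
  by move=> x /=; rewrite !in_itv /=; lra.
have [w wuv e] := MVT ltuv dfuv cfuv.
by exists w; move: wuv; rewrite /= !in_itv /=; lra.
Qed.

(** * Midpoints and the Newton operator *)

Lemma midpoint_itv (R : realType) (a b : R) :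
  a <= b -> midpoint [set` `[a, b]] = (a + b) / 2.
Proof. by move=> leab; rewrite /midpoint inf_itvcc // sup_itvcc. Qed.

Lemma midpoint_in (R : realType) (A : set R) :
  real_interval A -> A (midpoint A).
Proof.
by move=> [a [b [leab ->]]]; rewrite midpoint_itv //= in_itv /=; lra.
Qed.

Lemma NopE (R : realType) (f : R -> R) (F : set R -> set R) (A : set R)
    (u : R) :
  Nop f F A u <-> exists2 q : R, F A q & u = midpoint A - f (midpoint A) / q.
Proof.
split=> [[_ -> [_ [_ -> [q Aq <-]] <-]]|[q Aq ->]]; first by exists q.
by exists (midpoint A) => //; exists (f (midpoint A) / q) => //;
  exists (f (midpoint A)) => //; exists q.
Qed.

(* All the quotients in N(A) have the same sign. *)
Lemma Nop_halves (R : realType) (f : R -> R) (F : set R -> set R)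
    (A : set R) (w : R) :
  real_interval A -> real_interval (F A) -> ~ F A 0 ->
  (forall u v, A u -> A v -> `|u - v| <= w) ->
  forall u v, (Nop f F A `&` A) u -> (Nop f F A `&` A) v -> `|u - v| <= w / 2.
Proof.
move=> [a [b [leab eA]]] iF F0 diamA u v.
move=> [/NopE[p Fp eu] Au] [/NopE[q Fq ev] Av].
have [r r0 hr] := ratio_lower_bound iF F0.
have p0 : p != 0 by apply/eqP => p0; apply: F0; rewrite -p0.
have wab : b - a <= w.
  apply: le_trans (ler_norm _) _; apply: diamA;
  by rewrite eA /= in_itv /= lexx leab.
set t := f (midpoint A) in eu ev.
have tq : t / q = p / q * (t / p) by rewrite [RHS]mulrC mulrA divfK.
have pq0 : 0 < p / q := lt_le_trans r0 (hr _ _ Fp Fq).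
move: Au Av eu ev; rewrite eA /= !in_itv /= midpoint_itv // tq => ua va eu ev.
(* Both points lie in the same half of [[a, b]]: the left one if [t / p] is nonnegative, the right
   one otherwise. *)
rewrite ler_norml; have [s0|s0] := leP 0 (t / p).
  by have := mulr_ge0 (ltW pq0) s0; lra.
by have := mulr_ge0_le0 (ltW pq0) (ltW s0); lra.
Qed.

(** * Invariants and error bounds of the generated sequence *)

(** A point of [X k.+1] lies also in [Z k] and [Y k], so none of the three intersections is empty.
    The inclusion in [X 0] is carried along because [dF] is known to give intervals only there. *)
Lemma generated_interval (R : realType) (f df : R -> R)
    (dF : set R -> set R) (X Y Z : nat -> set R) :
  real_interval (X 0%N) -> interval_extension (X 0%N) dF df ->
  generated f dF X Y Z -> (forall k, zero_notin_value dF (X k)) ->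
  forall k, real_interval (X k) /\ X k `<=` X 0%N.
Proof.
move=> iX0 [idF _ _] gen h0; elim=> [|k [iX sX]]; first by split.
have [eY eZ eX] := gen k.
have [[u Xu] _] := h0 k.+1.
have [Tu Zu] : (Top f dF (X k) (Y k) (Z k) `&` Z k) u by rewrite -eX.
have [Ku Yu] : (Kop f dF (X k) (Y k) `&` Y k) u by rewrite -eZ.
have iq t : real_interval (idiv [set t] (dF (X k))).
  by apply: real_interval_idiv1; [exact: idF | case: (h0 k)].
have iY : real_interval (Y k).
  rewrite eY; apply: real_intervalI => //; last by rewrite -eY; exists u.
  exact: real_interval_isub1.
have iZ : real_interval (Z k).
  rewrite eZ; apply: real_intervalI => //; last by rewrite -eZ; exists u.
  exact/real_interval_isub1/real_interval_imul1.
split; last first.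
  by move=> x; rewrite eX eZ eY => -[_ [_ [_ /sX]]].
rewrite eX; apply: real_intervalI => //; last by rewrite -eX; exists u.
exact/real_interval_isub1/real_interval_imul1.
Qed.

Lemma generated_diameter (R : realType) (f df : R -> R)
    (dF : set R -> set R) (X Y Z : nat -> set R) :
  real_interval (X 0%N) -> interval_extension (X 0%N) dF df ->
  generated f dF X Y Z -> (forall k, zero_notin_value dF (X k)) ->
  exists w : R, forall k u v, X k u -> X k v -> `|u - v| <= w / 2 ^+ k.
Proof.
move=> iX0 hext gen h0; have := iX0 => -[a [b [leab eX0]]].
exists (b - a); elim=> [|k IH] u v.
  rewrite eX0 /= !in_itv /= expr0 divr1 => ua va.
  by rewrite ler_norml; lra.
have [eY eZ eX] := gen k; rewrite eX eZ => -[_ [_ Yu]] [_ [_ Yv]].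
rewrite eY in Yu Yv.
have [iX sX] := generated_interval iX0 hext gen h0 k.
rewrite exprSr invfM mulrA; apply: (Nop_halves _ _ _ IH Yu Yv) => //.
  by case: hext => idF _ _; exact: idF.
by case: (h0 k).
Qed.

(** The Newton step from the midpoint to [u] is the error of the midpoint times a ratio of two
    elements of [dF (X 0)]. Bounding that ratio over [X 0] makes [r] independent of [k]. *)
Lemma generated_midpoint_error (R : realType) (f df : R -> R)
    (dF : set R -> set R) (X Y Z : nat -> set R) (xstar : R) :
  real_interval (X 0%N) -> C1_on (X 0%N) f df ->
  interval_extension (X 0%N) dF df -> inclusion_monotonic (X 0%N) dF ->
  generated f dF X Y Z -> (forall k, zero_notin_value dF (X k)) ->
  X 0%N xstar -> f xstar = 0 ->
  exists2 r : R, 0 < r & forall k, exists2 u, X k u &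
    r * `|midpoint (X k) - xstar| <= `|midpoint (X k) - u|.
Proof.
move=> iX0 hf hext hmono gen h0 X0x fx.
have [idF _ dfF] := hext.
have [|r r0 hr] := ratio_lower_bound (idF _ iX0 (@subset_refl _ _)).
  by case: (h0 0%N).
exists r => // k; have [eY eZ eX] := gen k.
have [[u Xu] _] := h0 k.+1; exists u.
  by move: Xu; rewrite eX eZ eY => -[_ [_ []]].
have [/NopE[q Fq ->] _] : (Nop f dF (X k) `&` X k) u.
  by move: Xu; rewrite eX eZ eY => -[_ []].
have [iX sX] := generated_interval iX0 hext gen h0 k.
set x := midpoint (X k).
(* At this stage [xstar] is known to lie in [X 0] only, so [w] is sought there and not in [X k]. *)
have [w Dw] := C1_on_MVT iX0 hf (sX _ (midpoint_in iX)) X0x.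
rewrite fx subr0 -/x => ->.
rewrite subKr mulrAC normrM ler_wpM2r //.
apply: le_trans (ler_norm _); apply: hr.
  by apply: dfF => //; exists w.
exact: hmono sX _ Fq.
Qed.

Theorem theorem3 (R : realType) (f df : R -> R) (dF : set R -> set R)
    (X Y Z : nat -> set R)
    (hX0 : real_interval (X 0%N))
    (hf : C1_on (X 0%N) f df)
    (hext : interval_extension (X 0%N) dF df)
    (hmono : inclusion_monotonic (X 0%N) dF)
    (hgen : generated f dF X Y Z)
    (hden : denominators_nonzero f X Y Z)
    (h0 : forall k : nat, zero_notin_value dF (X k))
    (xstar : R) (hxX0 : X 0%N xstar) (hroot : f xstar = 0) :
  (forall k : nat, X k xstar) /\ nested X /\ converges_to X xstar.
Proof.
have nestX : nested X.
  by move=> k x; have [-> -> ->] := hgen k => -[_ [_ []]].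
have iX k : real_interval (X k).
  by case: (generated_interval hX0 hext hgen h0 k).
have leX j k : (j <= k)%N -> X k `<=` X j.
  move=> /subnK <-; elim: (k - j)%N => // i IH.
  exact: subset_trans (nestX _) IH.
have [w diamX] := generated_diameter hX0 hext hgen h0.
have [r r0 errX] :=
  generated_midpoint_error hX0 hf hext hmono hgen h0 hxX0 hroot.
have w0 : 0 <= w.
  by have := diamX 0%N _ _ hxX0 hxX0; rewrite subrr normr0 expr0 divr1.
have near_xstar e : 0 < e ->
    exists N, forall k u, (N <= k)%N -> X k u -> `|u - xstar| < e.
  (* The two terms bound, up to the factor [1 / 2 ^+ k], the distances from [u] to the midpoint and
     from the midpoint to [xstar]. Below, [e] is divided by [c + 1], which is positive even if [w]
     is 0. *)
  move=> e0; pose c := w + w / r.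
  have c0 : 0 <= c by rewrite addr_ge0 // divr_ge0 // ltW.
  have [N _ hN] :=
    near_infty_natSinv_expn_lt (PosNum (divr_gt0 e0 (ltr_wpDl c0 ltr01))).
  exists N => k u Nk Xu.
  have [v Xv hv] := errX k.
  have Xm := midpoint_in (iX k).
  have d1 := diamX k u _ Xu Xm.
  have d2 := diamX k _ v Xm Xv.
  have d3 : `|midpoint (X k) - xstar| <= w / r / 2 ^+ k.
    by rewrite mulrAC ler_pdivlMr // mulrC (le_trans hv).
  have := hN k Nk; rewrite /= ltr_pdivlMr ?ltr_wpDl // mul1r mulrC => hk.
  apply: le_lt_trans (ler_distD (midpoint (X k)) _ _) _.
  apply: le_lt_trans (lerD d1 d3) _; rewrite -mulrDl.
  apply: le_lt_trans hk; rewrite ler_wpM2r ?invr_ge0 ?exprn_ge0 //.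
  by rewrite /c; lra.
(* A point outside the closed interval [X k] has a positive distance [e] from it, hence from all
   later intervals, against [near_xstar]. *)
have Xx k : X k xstar.
  have [c [d [lecd eXk]]] := iX k.
  rewrite eXk /= in_itv /=; apply/negP => /negP.
  rewrite negb_and -!ltNge => xcd.
  have [e e0 he] : exists2 e : R, 0 < e & forall u, X k u -> e <= `|u - xstar|.
    case/orP: xcd => [xc|dx].
      exists (c - xstar); first lra.
      move=> u; rewrite eXk /= in_itv /= => ucd.
      by apply: le_trans (ler_norm _); lra.
    exists (xstar - d); first lra.
    move=> u; rewrite eXk /= in_itv /= => ucd.
    by rewrite distrC; apply: le_trans (ler_norm _); lra.
  have [N hN] := near_xstar e e0.
  have [[u Xu] _] := h0 (maxn N k).
  have := hN _ u (leq_maxl _ _) Xu.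
  by rewrite ltNge he //; exact: leX (leq_maxr _ _) _ Xu.
split=> //; split=> //; apply/seteqP; split=> [p Xp /=|_ -> k _ //].
(* A point common to all [X k] is closer to [xstar] than any positive [e]. *)
apply/eqP; rewrite -subr_eq0 -normr_le0; apply/ler_addgt0Pr => e e0.
have [N hN] := near_xstar e e0.
by rewrite add0r ltW // (hN N) //; exact: Xp.
Qed.
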